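(* Fix $f\in(0,1/2)$ and let $c'>0$ be an interval discrepancy constant (as defined in the context). Then there is a sequence of positive integers $M=M(n)$ with $$M=\frac{2^n}{\binom{n}{\le\lfloor fn\rfloor}}\cdot\frac{4}{1-2f}\,c'\sqrt{\log\log n}\,(1+o(1))\qquad(n\to\infty)$$ such that for all sufficiently large $n$, Paul can win the $((M,0,\dots,0),n,\lfloor fn\rfloor)^*_2$-game, i.e. the $n$-round pathological liar game with Yes-No questions, with $M$ elements all initially carrying $0$ lies, and with $\lfloor fn\rfloor$ lies.
   Context: $\mathbb{N}=\{0,1,2,\dots\}$; $\log$ is the natural logarithm; $\binom{n}{\le k}=\sum_{i=0}^{k}\binom ni$. Pathological liar game. Let $n,M,e\ge0$ be integers and $x=(x(0),\dots,x(e))$ a nonnegative integer vector with $\sum_i x(i)=M$. The $(x,n,e)^*_2$-game is played by Paul and Carole on the set $[M]=\{1,\dots,M\}$; initially exactly $x(i)$ elements carry $i$ lies, for $0\le i\le e$. In each of $n$ rounds, Paul chooses a partition $[M]=A_0\sqcup A_1$ (parts may be empty), then Carole, knowing the partition, chooses $j\in\{0,1\}$; each element of $A_{1-j}$ receives one additional lie, and elements of $A_j$ receive none. An element with at least $e+1$ lies is disqualified. Paul sees Carole's answer before asking the next question. Paul wins if at least one element is not disqualified after $n$ rounds. ''Paul can win'' means he has a winning strategy regardless of Carole's responses. Liar machine: a starting configuration is a map $f_0:\mathbb{Z}\to\mathbb{N}$ with finite support contained in $2\mathbb{Z}$ or in $2\mathbb{Z}+1$. Given $f_t$, let $\chi_t(j)=0$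 if $f_t(j)$ is even and $\chi_t(j)=(-1)^{\sum_{i<j}\chi_t(i)}$ if $f_t(j)$ is odd, and put $f_{t+1}(j)=\frac12\big(f_t(j-1)+f_t(j+1)+\chi_t(j-1)-\chi_t(j+1)\big)$. Linear machine: $g_{t+1}(j)=\frac12\big(g_t(j-1)+g_t(j+1)\big)$. Interval discrepancy constant: an absolute constant $c'>0$ such that for every starting configuration $f_0$, with $g_0=f_0$ and $f_t,g_t$ the evolutions of the liar machine and linear machine, every integer interval $I=\{a,a+1,\dots,b\}$ with $a<b$ and $B=b-a$, and every integer $t\ge0$, the quantity $\left|\sum_{i\in I}f_t(i)-\sum_{i\in I}g_t(i)\right|$ is at most $c'\sqrt t$ if $B>\sqrt t/2$ and at most $c'B\log(t/B^2)$ if $B\le\sqrt t/2$. (Such a constant exists.) *)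

(* Defs.v *)
From HB Require Import structures.
From mathcomp Require Export all_boot all_order all_algebra.
From mathcomp Require Export all_classical all_reals all_analysis.
Import Order.TTheory GRing.Theory Num.Theory.
Import numFieldNormedType.Exports.

Set Implicit Arguments.
Unset Strict Implicit.
Unset Printing Implicit Defensive.

Local Open Scope classical_set_scope.
Local Open Scope ring_scope.

Definition binom_le (n k : nat) : nat := (\sum_(i < k.+1) 'C(n, i))%N.

(** * Pathological liar game *)

(* A deterministic strategy for Paul: given Carole's answers so far (in
   chronological order), the part A_1 of his next partition A_0, A_1; the part
   A_0 is the complement. Carole's answers j = 0, 1 are encoded as booleans. *)
Definition strategy (T : finType) : Type := seq bool -> {set T}.

(* Lies carried by [y] after [n] rounds with answers [w]. In round [i], with
   answer [j], [y] gets a lie iff it lies in A_(1-j), i.e. iff the boolean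
   [y \in A_1] differs from [j]. *)
Definition lies_after (T : finType) (S : strategy T) (l0 : T -> nat)
    (n : nat) (w : n.-tuple bool) (y : T) : nat :=
  (l0 y + \sum_(i < n) ((y \in S (take i w)) != tnth w i))%N.

(* [S] is winning if it leaves a non-disqualified element against every
   sequence of answers; quantifying over sequences covers adaptive play by
   Carole, since [S] is deterministic. *)
Definition winning (T : finType) (e n : nat) (l0 : T -> nat)
    (S : strategy T) : Prop :=
  forall w : n.-tuple bool, exists y : T, (lies_after S l0 w y <= e)%N.

(* Paul can win the (x, n, e)^*_2-game. The initial assignment of lies is only
   constrained by [x], which, as the x(i) sum to the number of elements,
   forces every element to carry at most [e] lies at the start. *)
Definition paul_can_win (n e : nat) (x : 'I_e.+1 -> nat) : Prop :=
  forall l0 : 'I_(\sum_(i < e.+1) x i)%N -> nat,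
    (forall i : 'I_e.+1, #|[set y | l0 y == i :> nat]%SET| = x i) ->
    exists S : strategy 'I_(\sum_(i < e.+1) x i)%N, winning e n l0 S.

(* The vector (M, 0, ..., 0) of length e + 1. *)
Definition all_clean (e M : nat) (i : 'I_e.+1) : nat :=
  if i == ord0 then M else 0%N.

(** * Liar machine and linear machine *)

Definition starting_configuration (f0 : int -> nat) : Prop :=
  finite_set [set j | f0 j <> 0%N] /\
  ((forall j, f0 j <> 0%N -> (2 %| j)%Z) \/
   (forall j, f0 j <> 0%N -> ~~ (2 %| j)%Z)).

(* The recursion characterizing chi_t for the configuration f_t = f. When [f]
   has finite support the sum has finite support too, and the recursion has
   exactly one solution. *)
Definition is_chi (f : int -> nat) (chi : int -> int) : Prop :=
  forall j : int,
    chi j = if odd (f j)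
            then (-1) ^ (\sum_(i \in [set i : int | i < j]) chi i)
            else 0.

(* [F t] is f_t. The halved expression is always a nonnegative even integer, so
   the update is stated after multiplication by 2. *)
Definition liar_evolution (F : nat -> int -> nat) : Prop :=
  forall t : nat, exists2 chi : int -> int, is_chi (F t) chi &
    forall j : int,
      2 * (F t.+1 j)%:Z
      = (F t (j - 1))%:Z + (F t (j + 1))%:Z + chi (j - 1) - chi (j + 1).

Fixpoint linear_machine (R : realType) (g0 : int -> R) (t : nat) : int -> R :=
  if t is t'.+1 then
    fun j => (linear_machine g0 t' (j - 1) + linear_machine g0 t' (j + 1)) / 2
  else g0.

(* The interval {a, ..., b} is given by [a] and its length B = b - a > 0. *)
Definition interval_sum (R : realType) (u : int -> R) (a : int) (B : nat) : R :=
  \sum_(i < B.+1) u (a + i%:Z).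

Definition interval_discrepancy_constant (R : realType) (c : R) : Prop :=
  0 < c /\
  forall F : nat -> int -> nat,
    starting_configuration (F 0%N) -> liar_evolution F ->
    forall (a : int) (B t : nat), (0 < B)%N ->
      let discrepancy :=
        `| interval_sum (fun j => (F t j)%:R) a B
           - interval_sum (linear_machine (fun j => (F 0%N j)%:R) t) a B | : R in
      (Num.sqrt (t%:R : R) / 2 < B%:R -> discrepancy <= c * Num.sqrt (t%:R : R)) /\
      (B%:R <= Num.sqrt (t%:R : R) / 2 ->
         discrepancy <= c * B%:R * ln (t%:R / B%:R ^+ 2)).

(* Main.v *)
Require Import Defs.
From mathcomp Require Import zify ring lra.
Import Order.TTheory GRing.Theory Num.Theory.
Import numFieldNormedType.Exports.

(** Paul always asks a balanced question: among the elements with at most [y]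
    lies, the two parts have sizes that differ by at most one, for every [y] at
    once. Measure a position by [slack l y], the sum over all elements of the
    truncated difference [y - l x]; an element survives iff the slack at [e + 1]
    is positive. After a balanced question, each answer makes the slack at
    [y + 1] at least the floor of the mean of the slacks at [y + 1] and [y]
    ([slack_answered]). The liar machine with all chips starting at 0, read with
    position = 2 * lies - time, satisfies this recursion with equality, and the
    recursion is monotone. So Paul wins as soon as the machine keeps a chip with
    at most [e] lies after [n] steps ([paul_can_win_all_clean]).

    It remains to count those chips. The discrepancy constant is applied only
    to intervals so long that they reach beyond all chips on the left: restarted
    at any time [s], the machine and the linear machine differ after [m] more
    steps by at most [c * sqrt m] in the number of chips with at most [z] lies
    ([survivors_discrepancy]). Used over all [n] steps this error would swamp
    the main term, of order [sqrt (ln (ln n))]. It is therefore used over three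
    consecutive stages, the last two of lengths of order [ln n] and
    [ln (ln n)]. An error made before a stage of length [m] is averaged by the
    linear machine against the binomial law of parameter 1/2, but only through
    those [k <= (1/2 - x) * m], with [k] the number of lies received in the
    stage: for other [k] the trivial bound that counts are nonnegative is used
    instead. So the error shrinks by the exponentially small factor of
    [binomial_lower_tail], enough to turn [sqrt n], and in the next stage
    [sqrt (ln n)], into O(1). Discarding the other [k] loses only a small
    fraction of the main term, because a word with at most [f * n] ones, taken
    uniformly, has about a fraction [f < 1/2 - x] of ones in its last [m] letters
    ([ball_size_upper_tail]). [survivors_stage] is this argument for one stage.

    The error that survives is [c * sqrt m] for the last stage. With
    [A = 1 - 2 * f], a length about [(3 / A)^2 * ln (ln n)] makes the previous
    error negligible, and the last error is then about
    [(3 / A) * c * sqrt (ln (ln n))], below the expected number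
    [(4 / A) * c * sqrt (ln (ln n))] of surviving chips. *)

Set Implicit Arguments.
Unset Strict Implicit.
Unset Printing Implicit Defensive.

Local Open Scope classical_set_scope.
Local Open Scope ring_scope.

(** * Balanced questions *)

(** Adding elements in order of lies and putting every second one in [A]
    balances all the sublevel sets at once; the induction removes an element
    with the most lies, which belongs to a sublevel set only when the whole of
    [D] does. *)
Lemma balanced_subset (T : finType) (l : T -> nat) (D : {set T}) :
  exists2 A : {set T}, A \subset D &
    forall y, #|[set x in A | (l x <= y)%N]%SET|
              = #|[set x in D | (l x <= y)%N]%SET|./2.
Proof.
elim: {D}#|D| {-2}D (erefl #|D|) => [|n IH] D Dn.
  exists finset.set0; first exact: finset.sub0set.
  move/eqP: Dn; rewrite cards_eq0 => /eqP -> y.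
  rewrite (_ : [set x in _ | _]%SET = finset.set0) ?cards0 //.
  by apply/setP => x; rewrite !inE.
have /card_gt0P [x0 x0D] : (0 < #|D|)%N by rewrite Dn.
case: (@arg_maxnP _ x0 (mem D) l x0D) => x xD' xmax; have xD : x \in D by [].
have {xD'}xmax y : y \in D -> (l y <= l x)%N by move=> yD; apply: xmax.
have D'n : #|(D :\ x)%SET| = n by apply/eqP; rewrite -eqSS -Dn (cardsD1 x D) xD.
have [A AD' hA] := IH _ D'n.
have xA : x \notin A by apply/negP => /(fintype.subsetP AD'); rewrite !inE eqxx.
have AD : A \subset D by apply: fintype.subset_trans AD' (finset.subD1set _ _).
exists (if odd n then x |: A else A)%SET.
  by case: ifP => // _; rewrite finset.subUset finset.sub1set AD andbT.
move=> y; have [lxy|lxy] := leqP (l x) y.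
  have AE (B : {set T}) : B \subset D -> [set z in B | (l z <= y)%N]%SET = B.
    move=> BD; apply/setP => z; rewrite !inE; apply: andb_idr => zB.
    by apply: leq_trans lxy; apply: xmax; apply: (fintype.subsetP BD).
  rewrite !AE //; last by case: ifP => // _; rewrite finset.subUset finset.sub1set xD AD.
  have := hA y; rewrite !AE ?finset.subD1set // D'n => cA.
  by rewrite Dn; case: ifP => on; rewrite ?cardsU1 ?xA cA /=; lia.
rewrite (_ : [set z in D | _]%SET = [set z in (D :\ x)%SET | (l z <= y)%N]%SET).
  rewrite -hA; congr #|pred_of_set _|; apply/setP => z; rewrite !inE.
  case: ifP => // _; rewrite !inE; case: eqP => // ->.
  by rewrite (leqNgt _ y) lxy !andbF.
apply/setP => z; rewrite !inE; case: eqP => //= ->.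
by rewrite (leqNgt _ y) lxy andbF.
Qed.

(** Summing the sublevel counts [#|{x | l x <= z}|] over [z < y] gives this
    quantity. The counts themselves do not order the two answers to a question:
    one answer may leave more elements with at most [z] lies and fewer with at
    most [z + 1]. Their cumulative sums make one answer the worse at every
    level. *)
Definition slack (T : finType) (l : T -> nat) (y : nat) : nat :=
  (\sum_x (y - l x))%N.

Definition answered (T : finType) (A : {set T}) (l : T -> nat) (j : bool) : T -> nat :=
  fun x => (l x + ((x \in A) != j))%N.

Definition balanced_question (T : finType) (l : T -> nat) : {set T} :=
  sval (cid2 (balanced_subset l [set: T]%SET)).

(** [slack (answered A l j) y.+1] exceeds [slack l y] by the number of elements
    with at most [y] lies that are spared by the answer, and a balanced question
    spares at least half of them, rounded down. *)
Lemma slack_answered (T : finType) (l : T -> nat) (j : bool) (y : nat) :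
  ((slack l y.+1 + slack l y)./2 <= slack (answered (balanced_question l) l j) y.+1)%N.
Proof.
rewrite /balanced_question; case: cid2 => A /= _ /(_ y) hA.
have slackS (h : T -> nat) : (slack h y.+1 = slack h y + \sum_x (h x <= y))%N.
  by rewrite /slack -big_split /=; apply: eq_bigr => x _; case: leqP; lia.
have spared : (slack (answered A l j) y.+1
    = slack l y + \sum_x ((x \in A) == j) * (l x <= y))%N.
  rewrite /slack -big_split /=; apply: eq_bigr => x _; rewrite /answered.
  by case: eqP => _ /=; case: leqP; lia.
have cD : (\sum_x (l x <= y) = #|[set x in [set: T] | (l x <= y)%N]%SET|)%N.
  rewrite -sum1_card [RHS]big_mkcond; apply: eq_bigr => x _; rewrite !inE /=.
  by case: leqP.
have cA : (\sum_x (x \in A) * (l x <= y) = #|[set x in A | (l x <= y)%N]%SET|)%N.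
  rewrite -sum1_card [RHS]big_mkcond; apply: eq_bigr => x _; rewrite !inE /=.
  by case: (x \in A); case: leqP.
have cAC : (\sum_x ((x \in A) == j) * (l x <= y) =
   if j then \sum_x (x \in A) * (l x <= y)
   else \sum_x (l x <= y) - \sum_x (x \in A) * (l x <= y))%N.
  clear spared; case: j => //=; first by apply: eq_bigr => x _; case: (x \in A).
  apply/eqP; rewrite -(eqn_add2r (\sum_x (x \in A) * (l x <= y))) subnK.
    by rewrite -big_split /=; apply/eqP; apply: eq_bigr => x _; case: (x \in A); case: leqP.
  by apply: leq_sum => x _; case: (x \in A); rewrite ?mul1n /=.
rewrite spared slackS cAC cA hA -cD.
by case: j {spared cAC}; lia.
Qed.

Definition lies_along (T : finType) (l0 : T -> nat) (w : seq bool) : T -> nat :=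
  foldl (fun l j => answered (balanced_question l) l j) l0 w.

Definition balanced_strategy (T : finType) (l0 : T -> nat) : strategy T :=
  fun w => balanced_question (lies_along l0 w).

Lemma lies_after_balanced (T : finType) (l0 : T -> nat) (n : nat)
    (w : n.-tuple bool) (y : T) :
  lies_after (balanced_strategy l0) l0 w y = lies_along l0 w y.
Proof.
have prefix k : (k <= n)%N ->
    (l0 y + \sum_(i < k)
       ((y \in balanced_strategy l0 (take i w)) != nth false w i)
     = lies_along l0 (take k w) y)%N.
  elim: k => [|k IH] kn; first by rewrite big_ord0 take0 addn0.
  rewrite big_ord_recr /= addnA IH; last exact: ltnW.
  by rewrite (take_nth false) ?size_tuple // /lies_along -cats1 foldl_cat.
rewrite /lies_after; under eq_bigr => i _ do rewrite (tnth_nth false).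
by rewrite prefix // take_oversize // size_tuple.
Qed.

(** * The liar machine through its counting function *)

Section Machine.
Variable M : nat.

(** The liar machine is easier to run on its counting function: [chips_below t j]
    is the number of chips at positions [< j]. Among the chips listed from left
    to right, those of even rank (from 0) move right and the others left, so of
    the first [k] chips exactly [k./2] move left; this yields the update with
    [uphalf] and [half], and makes [liar_machine] satisfy the recursion with
    [chi]. All [M] chips start at 0. *)
Fixpoint chips_below (t : nat) (j : int) : nat :=
  if t is t'.+1 then
    (uphalf (chips_below t' (j - 1)) + (chips_below t' (j + 1))./2)%N
  else if 0 < j then M else 0%N.

Definition liar_machine (t : nat) (j : int) : nat :=
  (chips_below t (j + 1) - chips_below t j)%N.

Lemma chips_belowS t j : (chips_below t j <= chips_below t (j + 1))%N.
Proof.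
elim: t j => [|t IH] j /=; first by case: ifP; case: ifP; lia.
have h1 := IH (j - 1); have h2 := IH (j + 1).
rewrite (_ : j + 1 - 1 = j - 1 + 1); last by lia.
by rewrite leq_add ?uphalf_leq ?half_leq.
Qed.

Lemma chips_below_left t j : j <= - t%:Z -> chips_below t j = 0%N.
Proof.
elim: t j => [|t IH] j jt /=; first by rewrite ifF //; lia.
by rewrite !IH //; lia.
Qed.

Lemma chips_below_right t j : t%:Z < j -> chips_below t j = M.
Proof.
elim: t j => [|t IH] j jt /=; first by rewrite ifT //; lia.
by rewrite !IH; lia.
Qed.

Lemma chips_below_parity t j :
  odd (t + `|j|) -> chips_below t (j + 1) = chips_below t j.
Proof.
elim: t j => [|t IH] j jt /=.
  by case: ifP; case: ifP => //; lia.
have e1 : chips_below t j = chips_below t (j - 1).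
  by rewrite -[in LHS](subrK 1 j) IH //; lia.
have e2 : chips_below t (j + 1 + 1) = chips_below t (j + 1) by rewrite IH //; lia.
by rewrite addrK e1 e2.
Qed.
End Machine.

(** * From the liar machine to the game *)

(** A chip at position [2 * l - t] at time [t] is an element with [l] lies. The
    liar machine is the worst case for Paul because its slack obeys with
    equality the recursion that his slack obeys as a lower bound. *)
Lemma paul_can_win_all_clean (M n e : nat) :
    (0 < chips_below M n (2 * e%:Z - n%:Z + 1)%R)%N ->
  paul_can_win n (all_clean (e := e) M).
Proof.
move=> alive l0 hl0; exists (balanced_strategy l0) => w.
have M_sum : (\sum_(i < e.+1) all_clean M i = M)%N.
  by rewrite big_ord_recl /= /all_clean eqxx big1 ?addn0.
have clean y : l0 y = 0%N.
  have : [set y | l0 y == 0%N]%SET == [set: 'I_(\sum_(i < e.+1) all_clean M i)]%SET.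
    rewrite eqEcard finset.subsetT cardsT card_ord {1}M_sum.
    by have /= -> : #|[set y | l0 y == 0%N]%SET| = M := hl0 ord0.
  by move=> /eqP/setP/(_ y); rewrite !inE => /eqP.
(* A chip with [l] lies is counted once per level from [l] to [y - 1], so this
   is the sum of [y - l] over the chips, as in [slack]. *)
pose machine_slack t y : nat := (\sum_(l < y) chips_below M t (2 * l%:Z - t%:Z + 1)%R)%N.
have add_level t y : (machine_slack t y.+1
    = machine_slack t y + chips_below M t (2 * y%:Z - t%:Z + 1)%R)%N.
  exact: big_ord_recr.
have machine_slackS t y :
    machine_slack t.+1 y.+1 = (machine_slack t y.+1 + machine_slack t y)./2.
  have inner z : (machine_slack t.+1 z.+1 =
      machine_slack t z + (chips_below M t (2 * z%:Z - t%:Z + 1)%R)./2)%N.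
    elim: z => [|z IH].
      rewrite /machine_slack big_ord1 big_ord0 /= add0n chips_below_left; last by lia.
      by congr (chips_below _ _ _)./2; lia.
    rewrite add_level IH [in RHS]add_level /=.
    rewrite (_ : 2 * z.+1%:Z - t.+1%:Z + 1 - 1 = 2 * z%:Z - t%:Z + 1); last by lia.
    rewrite (_ : 2 * z.+1%:Z - t.+1%:Z + 1 + 1 = 2 * z.+1%:Z - t%:Z + 1); last by lia.
    by lia.
  by rewrite inner add_level; lia.
have dominates k : (k <= n)%N -> forall y,
    (machine_slack k y <= slack (lies_along l0 (take k w)) y)%N.
  elim: k => [|k IH] kn y.
    have -> : machine_slack 0%N y = (y * M)%N.
      elim: y => [|y IH]; first by rewrite /machine_slack big_ord0.
      by rewrite add_level IH chips_below_right; lia.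
    rewrite take0 /slack (eq_bigr (fun=> y)); last by move=> x _; rewrite /= clean subn0.
    by rewrite sum_nat_const card_ord M_sum mulnC.
  case: y => [|y]; first by rewrite /machine_slack big_ord0.
  rewrite machine_slackS (take_nth false) ?size_tuple // /lies_along -cats1 foldl_cat /=.
  apply: leq_trans (slack_answered _ _ _).
  by rewrite half_leq ?leq_add ?IH // ltnW.
have : (0 < slack (lies_along l0 w) e.+1)%N.
  rewrite -[X in lies_along _ X](@take_oversize _ n); last by rewrite size_tuple.
  apply: leq_trans (dominates n (leqnn n) e.+1).
  by rewrite add_level ltn_addl.
rewrite lt0n sum_nat_eq0 negb_forall => /existsP[x]; rewrite subn_eq0 -ltnNge ltnS => hx.
by exists x; rewrite lies_after_balanced.
Qed.

(** * The counting function describes a liar machine *)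

Section Evolution.
Variable M : nat.

(** The sign [chi_t] in closed form: the odd piles alternate, so the partial sums
    of [chi_t] are the parities of the numbers of chips to the left. *)
Definition drift (t : nat) (j : int) : int :=
  (odd (chips_below M t (j + 1)))%:Z - (odd (chips_below M t j))%:Z.

Lemma sum_drift t (j : int) :
  \sum_(i \in [set i : int | i < j]) drift t i = (odd (chips_below M t j))%:Z.
Proof.
pose N := (`|j| + t)%N.
have telescope n : \sum_(k < n) drift t (j - 1 - k%:Z)
    = (odd (chips_below M t j))%:Z - (odd (chips_below M t (j - n%:Z)))%:Z.
  elim: n => [|n IH]; first by rewrite big_ord0 subr0 subrr.
  rewrite big_ord_recr /= IH /drift.
  rewrite (_ : j - 1 - n%:Z + 1 = j - n%:Z); last by lia.
  by rewrite (_ : j - 1 - n%:Z = j - n.+1%:Z); lia.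
have far (i : int) : i < j ->
    ~ (exists2 k, (k < N)%N & j - 1 - k%:Z = i) -> drift t i = 0.
  move=> ij iN; have iN' : i <= j - 1 - N%:Z.
    rewrite leNgt; apply/negP => Ni; apply: iN.
    by exists `|(j - 1 - i)%R|%N; lia.
  by rewrite /drift !chips_below_left //; lia.
rewrite -(@fsbig_widen _ _ _ _ [set j - 1 - k%:Z | k in `I_N]).
- rewrite fsbig_image /=; last by move=> a b _ _; lia.
  transitivity (\sum_(k < N) drift t (j - 1 - k%:Z)).
    exact/esym/(fsbig_ord _ _ (fun k => drift t (j - 1 - k%:Z))).
  rewrite telescope.
  by rewrite (@chips_below_left _ _ (j - N%:Z)) ?subr0 //; lia.
- by move=> _ [k _ <-] /=; lia.
by move=> i [/= ij iN]; exact: far ij iN.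
Qed.

Lemma liar_evolution_liar_machine : liar_evolution (liar_machine M).
Proof.
move=> t; have mono := @chips_belowS M t; exists (drift t).
  move=> j; rewrite sum_drift /liar_machine oddB ?mono // /drift.
  by case: (odd (chips_below M t (j + 1))); case: (odd (chips_below M t j)).
move=> j; rewrite /liar_machine /drift /= !subrK !addrK.
have := mono (j - 1); have := mono j; have := mono (j + 1); rewrite subrK.
lia.
Qed.

Lemma starting_configuration_liar_machine t :
  starting_configuration (liar_machine M t).
Proof.
have parity j : liar_machine M t j <> 0%N -> ~~ odd (t + `|j|).
  move=> Fj; apply/negP => tj; apply: Fj.
  by rewrite /liar_machine chips_below_parity ?subnn.
split.
  apply: (@sub_finite_set _ _ [set k%:Z - t%:Z | k in `I_(t.*2.+1)]); last first.
    by apply: finite_image; exact: finite_II.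
  move=> j /= Fj.
  have jt : - t%:Z <= j.
    rewrite leNgt; apply/negP => jt; apply: Fj.
    by rewrite /liar_machine !chips_below_left //; lia.
  have tj : j <= t%:Z.
    rewrite leNgt; apply/negP => tj; apply: Fj.
    by rewrite /liar_machine !chips_below_right ?subnn //; lia.
  by exists `|(j + t%:Z)%R|%N => /=; lia.
by case: (boolP (odd t)) => ot; [right|left] => j /parity; lia.
Qed.
End Evolution.

(** * Binomial averages and Hamming balls *)

Section Binomial.
Variable R : realType.
Implicit Types (a : nat -> R) (z : int).

Definition bsum (m : nat) a : R := \sum_(k < m.+1) 'C(m, k)%:R * a k.

Lemma bsum0 a : bsum 0 a = a 0%N.
Proof. by rewrite /bsum big_ord_recl big_ord0 addr0 mul1r. Qed.

Lemma bsumS m a : bsum m.+1 a = bsum m a + bsum m (a \o succn).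
Proof.
rewrite /bsum big_ord_recl /= bin0 mul1r.
under eq_bigr => i _ do rewrite /bump /= add1n binS natrD mulrDl.
rewrite big_split /= addrA; congr (_ + _).
rewrite big_ord_recr /= bin_small // mul0r addr0.
by rewrite [RHS]big_ord_recl /= bin0 mul1r.
Qed.

Lemma eq_bsum m a a' : a =1 a' -> bsum m a = bsum m a'.
Proof. by move=> aa'; apply: eq_bigr => k _; rewrite aa'. Qed.

Lemma le_bsum m a a' : (forall k, a k <= a' k) -> bsum m a <= bsum m a'.
Proof. by move=> aa'; apply: ler_sum => k _; rewrite ler_wpM2l. Qed.

Lemma bsumZ m c a : bsum m (fun k => c * a k) = c * bsum m a.
Proof. by rewrite /bsum mulr_sumr; apply: eq_bigr => k _; rewrite mulrCA. Qed.

Lemma bsumB m a a' : bsum m (fun k => a k - a' k) = bsum m a - bsum m a'.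
Proof. by rewrite /bsum -sumrB; apply: eq_bigr => k _; rewrite mulrBr. Qed.

Lemma bsum_exp m (x : R) : bsum m (fun k => x ^+ k) = (1 + x) ^+ m.
Proof.
elim: m => [|m IH]; first by rewrite bsum0.
rewrite bsumS IH (@eq_bsum _ _ (fun k => x * x ^+ k)) ?bsumZ ?IH ?exprS; first ring.
by move=> k /=; rewrite exprS.
Qed.

(** [binom_le] extended by 0 to negative radii, so that the Pascal rule
    [ball_sizeS] needs no boundary case. *)
Definition ball_size (t : nat) z : R :=
  if z is Posz e then (binom_le t e)%:R else 0.

Lemma ball_size_ge0 t z : 0 <= ball_size t z.
Proof. by case: z. Qed.

Lemma ball_sizeS t z : ball_size t.+1 z = ball_size t z + ball_size t (z - 1).
Proof.
case: z => [[|e]|e]; last by rewrite /= addr0.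
  by rewrite /= /binom_le !big_ord1 !bin0 addr0.
have -> : (Posz e.+1 - 1 = Posz e)%R by lia.
rewrite /= -natrD; congr _%:R; rewrite /binom_le big_ord_recl /= bin0.
under eq_bigr => i _ do rewrite /bump /= add1n binS.
by rewrite big_split /= addnA [in RHS]big_ord_recl bin0.
Qed.

Lemma ball_size0 z : ball_size 0 z = (0 <= z)%R%:R.
Proof.
by case: z => e //=; rewrite /binom_le big_ord_recl bin0 big1 ?addn0.
Qed.

Lemma bsum_ball_size m s z :
  bsum m (fun k => ball_size s (z - k%:Z)) = ball_size (s + m) z.
Proof.
elim: m z => [|m IH] z; first by rewrite bsum0 subr0 addn0.
rewrite bsumS IH addnS ball_sizeS -(IH (z - 1)); congr (_ + _); apply: eq_bsum => k /=.
by congr ball_size; lia.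
Qed.

(** Among the words of length [t + 1] with at most [z] ones, the fraction that
    ends with a one is at most [z / (t + 1)]. Termwise this is
    [i * 'C(t + 1, i) = (t + 1) * 'C(t, i - 1)] with [i <= z]. *)
Lemma ball_size_shrink (phi : R) t z : 0 <= phi -> z%:~R <= phi * t.+1%:R ->
  ball_size t (z - 1) <= phi * ball_size t.+1 z.
Proof.
case: z => [[|e]|e] phi0 zt; rewrite ?mulr_ge0 //; try by rewrite mulr0.
have -> : (Posz e.+1 - 1 = Posz e)%R by lia.
rewrite /= -(@ler_pM2l _ t.+1%:R) ?ltr0Sn //.
have h : (t.+1 * binom_le t e <= e.+1 * binom_le t.+1 e.+1)%N.
  rewrite /binom_le !big_distrr /= [X in (_ <= X)%N]big_ord_recl.
  apply: leq_trans (leq_addl _ _); apply: leq_sum => i _ /=.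
  by rewrite /bump add1n mul_bin_diag leq_mul2r; apply/orP; right; case: i.
apply: (@le_trans _ _ (e.+1 * binom_le t.+1 e.+1)%:R).
  by rewrite -natrM ler_nat.
by rewrite natrM mulrA ler_wpM2r // mulrC.
Qed.

Lemma inv1B_expR (x : R) : x < 1 -> expR x <= (1 - x)^-1.
Proof.
move=> x1; rewrite -[x in expR x]opprK expRN lef_pV2 ?posrE ?expR_gt0 //; last by lra.
exact: expR_ge1Dx.
Qed.

(** The rate of decay, per letter, of the proportion of words having at most a
    fraction [1/2 - x] of ones. The optimal exponent is close to [2 * x ^+ 2];
    4/5 is what the bound [1 / (1 - x ^+ 2)] on the hyperbolic cosine gives for
    [x <= 3/8]. *)
Definition lower_tail_ratio (x : R) : R := expR (- (4 / 5 * x ^+ 2)).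

(** Chernoff bound with weight [expR (- (2 * x))] per one: the generating
    function factors into [m] equal terms, each a hyperbolic cosine of [x] times
    an exponential. *)
Lemma binomial_lower_tail (x : R) m : 0 <= x <= 3 / 8 ->
  bsum m (fun k => (k%:R <= (1 / 2 - x) * m%:R)%R%:R)
    <= 2 ^+ m * lower_tail_ratio x ^+ m.
Proof.
move=> /andP[x0 x38].
have x2 : 0 <= x ^+ 2 <= 9 / 64 by rewrite sqr_ge0 /=; nra.
have base : (1 + expR (- (2 * x))) * expR (2 * x * (1 / 2 - x))
    <= 2 * lower_tail_ratio x.
  have -> : (1 + expR (- (2 * x))) * expR (2 * x * (1 / 2 - x))
      = (expR x + expR (- x)) * expR (- (2 * x ^+ 2)).
    rewrite !mulrDl mul1r -!expRD; congr (expR _ + expR _); by field.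
  have cosh : expR x + expR (- x) <= 2 * (1 - x ^+ 2)^-1.
    apply: le_trans (lerD (inv1B_expR _) (inv1B_expR _)) _; try lra.
    by rewrite le_eqVlt; apply/orP; left; apply/eqP; field; nra.
  have : (1 - x ^+ 2)^-1 <= expR (6 / 5 * x ^+ 2).
    apply: le_trans (expR_ge1Dx _).
    by rewrite -div1r ler_pdivrMr; move: (x ^+ 2) x2 => y /andP[y0 y9]; nra.
  move=> h; have {cosh}h2 : expR x + expR (- x) <= 2 * expR (6 / 5 * x ^+ 2) by lra.
  apply: le_trans (ler_wpM2r (expR_ge0 _) h2) _.
  by rewrite -[leLHS]mulrA -expRD /lower_tail_ratio ler_pM2l // ler_expR; lra.
rewrite -exprMn.
apply: (@le_trans _ _ (bsum m (fun k =>
    expR (2 * x * (1 / 2 - x)) ^+ m * expR (- (2 * x)) ^+ k))).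
  apply: le_bsum => k; case: (boolP (k%:R <= (1 / 2 - x) * m%:R)) => [kle|_] /=; last first.
    by rewrite mulr_ge0 ?exprn_ge0 ?expR_ge0.
  rewrite -!expRM_natl -expRD -[leLHS]expR0 ler_expR.
  have -> : m%:R * (2 * x * (1 / 2 - x)) + k%:R * - (2 * x)
      = 2 * x * ((1 / 2 - x) * m%:R - k%:R) by ring.
  by rewrite !mulr_ge0 ?subr_ge0.
by rewrite bsumZ bsum_exp -exprMn mulrC lerXn2r ?nnegrE ?mulr_ge0 ?expR_ge0 ?addr_ge0.
Qed.

(** The base of the Chernoff bound for more than [(phi + ga) * m] successes of
    probability [phi], with exponential weight [expR ga] per success. *)
Definition upper_tail_ratio (phi ga : R) : R :=
  (1 + (expR ga - 1) * phi) * expR (- (ga * (phi + ga))).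

Lemma upper_tail_ratio_ge0 phi ga : 0 <= phi -> 0 <= ga -> 0 <= upper_tail_ratio phi ga.
Proof.
move=> phi0 ga0; rewrite mulr_ge0 ?expR_ge0 ?addr_ge0 ?mulr_ge0 ?subr_ge0 //.
by apply: le_trans (expR_ge1Dx _); lra.
Qed.

Lemma upper_tail_ratio_lt1 phi ga : 0 <= phi -> 0 < ga -> phi + ga < 1 ->
  upper_tail_ratio phi ga < 1.
Proof.
move=> phi0 ga0 s1; have ga1 : ga < 1 by lra.
apply: (@le_lt_trans _ _ (expR ((expR ga - 1) * phi - ga * (phi + ga)))).
  by rewrite expRD ler_wpM2r ?expR_ge0 ?expR_ge1Dx.
rewrite expR_lt1 subr_lt0.
apply: (@le_lt_trans _ _ (((1 - ga)^-1 - 1) * phi)).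
  by rewrite ler_wpM2r // lerB ?inv1B_expR.
rewrite -(@ltr_pM2r _ (1 - ga)); last by lra.
rewrite (_ : ((1 - ga)^-1 - 1) * phi * (1 - ga) = ga * phi); last by field; lra.
by rewrite -mulrA ltr_pM2l //; nra.
Qed.

(** The weights [lam ^+ k] are introduced one letter at a time: each of the [m]
    letters is a one for at most a fraction [phi] of the words, so weighting
    those by [lam >= 1] multiplies the total by at most
    [1 + (lam - 1) * phi]. This avoids any computation with the hypergeometric
    law. *)
Lemma bsum_exp_ball_size (phi lam : R) m s z :
    0 <= phi -> 1 <= lam -> z%:~R <= phi * s%:R ->
  bsum m (fun k => lam ^+ k * ball_size s (z - k%:Z))
    <= (1 + (lam - 1) * phi) ^+ m * ball_size (s + m) z.
Proof.
move=> phi0 lam1; elim: m z => [|m IH] z zs.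
  by rewrite bsum0 subr0 addn0 !expr0.
have rho0 : 0 <= 1 + (lam - 1) * phi by rewrite addr_ge0 ?mulr_ge0 ?subr_ge0.
rewrite bsumS (@eq_bsum _ (_ \o succn)
  (fun k => lam * (lam ^+ k * ball_size s (z - 1 - k%:Z)))); last first.
  by move=> k /=; rewrite exprS -mulrA (_ : z - 1 - k%:Z = z - k.+1%:Z) //; lia.
have zs1 : (z - 1)%:~R <= phi * s%:R by apply: le_trans zs; rewrite ler_int; lia.
have := IH _ zs1; rewrite -(ler_pM2l (lt_le_trans ltr01 lam1)) => h1.
rewrite bsumZ; apply: le_trans (lerD (IH _ zs) h1) _.
rewrite mulrCA -mulrDr exprSr -mulrA ler_wpM2l ?exprn_ge0 // addnS.
have zsm : z%:~R <= phi * (s + m).+1%:R.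
  by apply: le_trans zs _; rewrite ler_wpM2l // ler_nat; lia.
have := ball_size_shrink phi0 zsm.
rewrite -(subr_ge0 1) in lam1; move=> /(ler_wpM2l lam1).
have := ball_sizeS (s + m) z; lra.
Qed.

(** Words with at most [z <= phi * s] ones rarely have more than a fraction
    [phi + ga] of ones among their last [m] letters: Chernoff bound with weight
    [expR ga] per one. *)
Lemma ball_size_upper_tail (phi ga : R) m s z :
    0 <= phi -> 0 <= ga -> z%:~R <= phi * s%:R ->
  bsum m (fun k => ((phi + ga) * m%:R < k%:R)%R%:R * ball_size s (z - k%:Z))
    <= upper_tail_ratio phi ga ^+ m * ball_size (s + m) z.
Proof.
move=> phi0 ga0 zs; have lam1 : 1 <= expR ga.
  by apply: le_trans (expR_ge1Dx _); lra.
apply: (@le_trans _ _ (bsum m (fun k => expR (- (ga * (phi + ga))) ^+ m *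
    (expR ga ^+ k * ball_size s (z - k%:Z))))).
  apply: le_bsum => k; rewrite mulrA ler_wpM2r ?ball_size_ge0 //.
  case: (boolP ((phi + ga) * m%:R < k%:R)) => [kgt|_] /=; last first.
    by rewrite mulr_ge0 ?exprn_ge0 ?expR_ge0.
  rewrite -!expRM_natl -expRD -[leLHS]expR0 ler_expR.
  by rewrite /= mulrN addrC subr_ge0 mulrC -mulrA [leRHS]mulrC ler_wpM2l // ltW.
rewrite bsumZ [upper_tail_ratio _ _ ^+ _]exprMn [_ ^+ m * _ ^+ m]mulrC -mulrA.
by rewrite ler_wpM2l ?exprn_ge0 ?expR_ge0 // bsum_exp_ball_size.
Qed.

End Binomial.

(** * Counting surviving chips *)

Lemma linear_machine_bsum (R : realType) (g : int -> R) t j :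
  linear_machine g t j
    = (2 ^+ t)^-1 * bsum t (fun k => g (j + t%:Z - 2 * k%:Z)).
Proof.
elim: t j => [|t IH] j; first by rewrite bsum0 expr0 invr1 mul1r subr0 addr0.
have stay : bsum t (fun k => g (j + 1 + t%:Z - 2 * k%:Z))
    = bsum t (fun k => g (j + t.+1%:Z - 2 * k%:Z)).
  by apply: eq_bsum => k; congr g; lia.
have lie : bsum t (fun k => g (j - 1 + t%:Z - 2 * k%:Z))
    = bsum t ((fun k => g (j + t.+1%:Z - 2 * k%:Z)) \o succn).
  by apply: eq_bsum => k /=; congr g; lia.
by rewrite /= !IH bsumS stay lie exprS invfM; ring.
Qed.

Lemma interval_sum_telescope (R : realType) (h : int -> R) a B :
  interval_sum (fun j => h (j + 1) - h j) a B = h (a + B%:Z + 1) - h a.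
Proof.
rewrite /interval_sum; elim: B => [|B IH]; first by rewrite big_ord1 addr0.
rewrite big_ord_recr /= IH (_ : a + B.+1%:Z = a + B%:Z + 1); last by lia.
by rewrite addrC subrKA.
Qed.

Section Counts.
Variables (R : realType) (M : nat).

(** The number of chips with at most [z] lies at time [t]: such a chip is at a
    position [<= 2 * z - t]. *)
Definition survivors (t : nat) (z : int) : R :=
  (chips_below M t (2 * z - t%:Z + 1))%:R.

(** The discrepancy bound restarted at time [s], for the interval of length [B]
    ending at the position of [z] lies; [B] is so large that the interval starts
    left of all chips and falls under the bound [c * sqrt m]. Counts being
    differences of cumulative counts, both interval sums telescope. *)
Lemma survivors_discrepancy (c : R) s m z : interval_discrepancy_constant c ->
  (2 ^+ m)^-1 * bsum m (fun k => survivors s (z - k%:Z)) - c * Num.sqrt m%:R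
    <= survivors (s + m) z.
Proof.
move=> [_ hc].
pose F t := liar_machine M (s + t).
have evF : liar_evolution F.
  by move=> t; rewrite /F addnS; exact: liar_evolution_liar_machine.
have := hc F; rewrite {1}/F => /(_ (starting_configuration_liar_machine _ _) evF).
pose u t j : R := (chips_below M t j)%:R.
have FE t j : (F t j)%:R = u (s + t)%N (j + 1) - u (s + t)%N j.
  by rewrite /F /liar_machine natrB ?chips_belowS.
pose j : int := 2 * z - (s + m)%N%:Z + 1.
pose B := (`|j| + s + m).+1.
pose U i := (2 ^+ m)^-1 * bsum m (fun k => u s (i + m%:Z - 2 * k%:Z)).
move=> /(_ (j - 1 - B%:Z) B m isT) [+ _].
have -> : interval_sum (fun i => (F m i)%:R) (j - 1 - B%:Z) B
    = survivors (s + m) z.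
  rewrite (_ : (fun i => _) = fun i => u (s + m)%N (i + 1) - u (s + m)%N i); last first.
    by apply/funext => i; rewrite FE.
  rewrite interval_sum_telescope !subrK /survivors -/j /u.
  by rewrite [X in _ - X%:R]chips_below_left ?subr0 //; lia.
have -> : interval_sum (linear_machine (fun i => (F 0%N i)%:R) m) (j - 1 - B%:Z) B
    = (2 ^+ m)^-1 * bsum m (fun k => survivors s (z - k%:Z)).
  rewrite (_ : linear_machine _ _ = fun i => U (i + 1) - U i); last first.
    apply/funext => i; rewrite linear_machine_bsum /U -mulrBr -bsumB.
    congr (_ * _); apply: eq_bsum => k; rewrite FE addn0.
    by congr (u s _ - _); lia.
  rewrite interval_sum_telescope !subrK.
  have -> : U (j - 1 - B%:Z) = 0.
    rewrite /U -[RHS](mulr0 (2 ^+ m)^-1) /bsum big1 // => k _.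
    by rewrite /u chips_below_left ?mulr0 //; lia.
  rewrite subr0 /U; congr (_ * _); apply: eq_bsum => k.
  by rewrite /u /survivors; congr (chips_below _ _ _)%:R; lia.
move=> /(_ _)/ler_normlP[|]; last by lra.
have mB : m.+1%:R <= B%:R :> R by rewrite ler_nat; lia.
apply: lt_le_trans mB.
have sm : Num.sqrt (m%:R : R) <= m.+1%:R.
  rewrite -[leRHS]ger0_norm // -sqrtr_sqr ler_wsqrtr // -natrX ler_nat.
  by nia.
have : (0 : R) < m.+1%:R by rewrite ltr0Sn.
lra.
Qed.

(** One stage of [m] steps. The lower bound at time [s] is inserted in the
    average of the linear machine only for [k <= (1/2 - x) * m] additional lies;
    the others are bounded by 0. The inherited error [err] is then weighted by
    a lower binomial tail, and the part of the main term that is given up is an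
    upper tail. *)
Lemma survivors_stage (c x phi ga al err : R) s m z :
    interval_discrepancy_constant c -> 0 <= x <= 3 / 8 -> 0 <= phi -> 0 <= ga ->
    phi + ga = 1 / 2 - x -> 0 <= al -> 0 <= err ->
    z%:~R <= phi * s%:R ->
    (forall y, y <= z -> al * ball_size R s y - err <= survivors s y) ->
  al * (2 ^+ m)^-1 * (1 - upper_tail_ratio phi ga ^+ m) * ball_size R (s + m) z
    - (err * lower_tail_ratio x ^+ m + c * Num.sqrt m%:R)
    <= survivors (s + m) z.
Proof.
move=> hc hx phi0 ga0 phiga al0 err0 zs start.
apply: le_trans (survivors_discrepancy s m z hc).
rewrite opprD addrA lerB // -!mulrA [al * _]mulrCA.
rewrite -(ler_pM2l (_ : 0 < 2 ^+ m)) ?exprn_gt0 // mulrBr !mulVKf ?expf_neq0 //.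
pose low k := (k%:R <= (1 / 2 - x) * m%:R :> R)%R%:R : R.
pose high k := ((phi + ga) * m%:R < k%:R :> R)%R%:R : R.
have lowE k : low k = 1 - high k.
  by rewrite /low /high phiga; case: leP => _ /=; rewrite ?subr0 ?subrr.
apply: (@le_trans _ _ (al * (bsum m (fun k => ball_size R s (z - k%:Z))
    - bsum m (fun k => high k * ball_size R s (z - k%:Z))) - err * bsum m low)).
  rewrite bsum_ball_size lerB //.
    rewrite ler_wpM2l // mulrBl mul1r lerB //.
    exact: ball_size_upper_tail.
  rewrite mulrCA ler_wpM2l //.
  exact: binomial_lower_tail.
rewrite -bsumB -!bsumZ -bsumB; apply: le_bsum => k.
have low01 : low k = 0 \/ low k = 1 by rewrite /low; case: (_ <= _)%R; [right|left].
have := start (z - k%:Z); have := lowE k.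
case: low01 => -> hk.
  by move=> _; rewrite /survivors (_ : high k = 1) ?mul1r ?subrr ?mulr0 ?subr0 //; lra.
rewrite (_ : high k = 0) ?mul0r ?subr0 ?mulr1; last by lra.
by apply; lia.
Qed.

End Counts.

(** * Three stages *)

Section Asymptotics.
Variable R : realType.

Lemma survivors_three_stages M (c x phi ga : R) n1 m2 m3 z :
    let q := lower_tail_ratio x in let del := upper_tail_ratio phi ga in
    interval_discrepancy_constant c -> 0 <= x <= 3 / 8 -> 0 <= phi -> 0 < ga ->
    phi + ga = 1 / 2 - x -> z%:~R <= phi * n1%:R ->
  M%:R / 2 ^+ (n1 + m2 + m3) * (1 - del ^+ m2) * (1 - del ^+ m3)
      * ball_size R (n1 + m2 + m3) z
    - ((c * Num.sqrt n1%:R * q ^+ m2 + c * Num.sqrt m2%:R) * q ^+ m3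
       + c * Num.sqrt m3%:R)
    <= survivors R M (n1 + m2 + m3) z.
Proof.
move=> q del hc hx phi0 ga0 phiga zn; have ga0' := ltW ga0.
have c0 : 0 <= c by case: hc => /ltW.
have del0 : 0 <= del by exact: upper_tail_ratio_ge0.
have del1 : del <= 1 by apply/ltW/upper_tail_ratio_lt1 => //; case/andP: hx; lra.
have le_phi y s : y <= z -> (n1 <= s)%N -> y%:~R <= phi * s%:R.
  move=> yz ns; apply: le_trans (_ : z%:~R <= _); first by rewrite ler_int.
  by apply: le_trans zn _; rewrite ler_wpM2l // ler_nat.
have stage1 y : M%:R / 2 ^+ n1 * ball_size R n1 y - c * Num.sqrt n1%:R
    <= survivors R M n1 y.
  have := survivors_discrepancy M 0 n1 y hc; rewrite add0n; apply: le_trans.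
  rewrite -[X in ball_size _ X]add0n -bsum_ball_size mulrAC mulrC -bsumZ.
  rewrite lerD2r ler_wpM2l // le_bsum // => k.
  rewrite ball_size0 /survivors /=; case: (leP 0 (y - k%:Z)) => yk.
    by rewrite ifT ?mulr1 //; lia.
  by rewrite mulr0.
have stage2 y : y <= z ->
    M%:R / 2 ^+ n1 * (2 ^+ m2)^-1 * (1 - del ^+ m2) * ball_size R (n1 + m2) y
      - (c * Num.sqrt n1%:R * q ^+ m2 + c * Num.sqrt m2%:R)
    <= survivors R M (n1 + m2) y.
  move=> yz; apply: survivors_stage => //; rewrite ?mulr_ge0 ?sqrtr_ge0 //.
  exact: le_phi.
have := @survivors_stage R M c x phi ga
  (M%:R / 2 ^+ n1 * (2 ^+ m2)^-1 * (1 - del ^+ m2))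
  (c * Num.sqrt n1%:R * q ^+ m2 + c * Num.sqrt m2%:R) (n1 + m2) m3 z hc hx phi0 ga0' phiga.
rewrite -/q -/del !exprD; set B := ball_size _ _ _.
rewrite (_ : M%:R / (2 ^+ n1 * 2 ^+ m2 * 2 ^+ m3) * (1 - del ^+ m2) * (1 - del ^+ m3) * B
  = M%:R / 2 ^+ n1 / 2 ^+ m2 * (1 - del ^+ m2) / 2 ^+ m3 * (1 - del ^+ m3) * B).
  apply=> //.
  - by rewrite !mulr_ge0 ?subr_ge0 ?exprn_ile1 // invr_ge0 exprn_ge0.
  - by rewrite addr_ge0 ?mulr_ge0 ?sqrtr_ge0 ?exprn_ge0 ?expR_ge0.
  - by apply: le_phi; rewrite ?leq_addr.
by rewrite !invfM; ring.
Qed.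

Lemma ball_size_le t z : ball_size R t z <= 2 ^+ t.
Proof.
elim: t z => [|t IH] z; first by rewrite ball_size0 expr0 lern1 leq_b1.
by rewrite ball_sizeS exprS mulr_natl mulr2n lerD.
Qed.

Lemma near_ln_ln (B : R) : \forall n \near \oo, B <= ln (ln (n%:R : R)).
Proof.
near=> n.
have h : expR (expR B) <= n%:R by near: n; exact: nbhs_infty_ger.
have h1 : expR B <= ln n%:R.
  by rewrite -ler_expR lnK // posrE; apply: lt_le_trans h; exact: expR_gt0.
by rewrite -ler_expR lnK // posrE; apply: lt_le_trans h1; exact: expR_gt0.
Unshelve. all: by end_near.
Qed.

(** Long enough for [lower_tail_ratio] with [x = 3/8 * A] to reduce an error by
    the factor [expR (- L)], as [4/5 * x ^+ 2 * (3 / A) ^+ 2] is [81/80]. *)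
Definition stage_length (A L : R) : nat := (Num.truncn ((3 / A) ^+ 2 * L)).+1.

Lemma stage_length_gt (A L : R) : 0 <= L -> (3 / A) ^+ 2 * L < (stage_length A L)%:R.
Proof. by move=> L0; rewrite /stage_length truncnS_gt. Qed.

Lemma stage_length_le (A L : R) : 0 <= L -> (stage_length A L)%:R <= (3 / A) ^+ 2 * L + 1.
Proof.
by move=> L0; rewrite /stage_length -natr1 lerD2r truncn_le mulr_ge0 ?sqr_ge0.
Qed.

Lemma sqrt_stage_length (A L : R) : 0 < A -> 0 <= L ->
  Num.sqrt (stage_length A L)%:R <= 3 / A * Num.sqrt L + 1.
Proof.
move=> A0 L0.
have s0 : 0 <= 3 / A * Num.sqrt L by rewrite mulr_ge0 ?sqrtr_ge0 ?divr_ge0 // ltW.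
rewrite -[leRHS]ger0_norm ?addr_ge0 // -sqrtr_sqr ler_wsqrtr //.
apply: le_trans (stage_length_le _ L0) _.
by rewrite sqrrD1 [(3 / A * _) ^+ 2]exprMn sqr_sqrtr // -addrA lerD2l lerDr mulrn_wge0.
Qed.

Lemma stage_length_decay (A L : R) : 0 < A -> 0 <= L ->
  lower_tail_ratio (3 / 8 * A) ^+ stage_length A L <= expR (- L).
Proof.
move=> A0 L0; rewrite /lower_tail_ratio -expRM_natl ler_expR mulrN lerN2.
have := stage_length_gt A L0; rewrite expr_div_n => h.
apply: (@le_trans _ _ (3 ^+ 2 / A ^+ 2 * L * (4 / 5 * (3 / 8 * A) ^+ 2))); last first.
  by rewrite ler_wpM2r ?mulr_ge0 ?sqr_ge0 // ltW.
rewrite (_ : _ * _ = 81 / 80 * L); first lra.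
by field; rewrite gt_eqF.
Qed.

End Asymptotics.

(** * The number of elements *)

Section Final.
Variable R : realType.

Definition final_count (f c : R) (n : nat) : R :=
  4 / (1 - 2 * f) * c * Num.sqrt (ln (ln n%:R)).

Definition threshold (f c : R) (n : nat) : R :=
  2 ^+ n / (binom_le n (Num.truncn (f * n%:R)))%:R * final_count f c n.

Lemma binom_le_gt0 n k : (0 < binom_le n k)%N.
Proof. by rewrite /binom_le big_ord_recl bin0. Qed.

(** Both stages have length [O (ln n)], and [ln n <= 2 * sqrt n]. *)
Lemma near_stage_lengths_small (A eta : R) : 0 < A -> 0 < eta ->
  \forall n \near \oo, (stage_length A (ln n%:R))%:R
    + (stage_length A (ln (ln n%:R)))%:R <= eta * n%:R.
Proof.
move=> A0 eta0; pose K := (3 / A) ^+ 2.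
have K0 : 0 <= K by exact: sqr_ge0.
near=> n.
have LL1 : 1 <= ln (ln (n%:R : R)) by near: n; exact: near_ln_ln.
have LL0 : 0 <= ln (ln (n%:R : R)) by lra.
have L1 : 1 <= ln (n%:R : R).
  by rewrite leNgt; apply/negP => /ltW/ln_le0; lra.
have L0 : 0 <= ln (n%:R : R) by lra.
have LLL : ln (ln n%:R) <= ln (n%:R : R) by apply/ltW/ln_sublinear; lra.
have n0 : (0 : R) < n%:R.
  by rewrite ltNge; apply/negP => n0; move: L1; rewrite ln0 //; lra.
have Ls : ln (n%:R : R) <= 2 * Num.sqrt n%:R.
  rewrite -[X in ln X](sqr_sqrtr (ltW n0)) lnXn ?sqrtr_gt0 // mulr2n.
  by have := @ln_sublinear R (Num.sqrt n%:R); rewrite sqrtr_gt0 n0 => /(_ isT); lra.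
have s_large : (4 * K + 2) / eta <= Num.sqrt (n%:R : R).
  have h : ((4 * K + 2) / eta) ^+ 2 <= n%:R by near: n; exact: nbhs_infty_ger.
  rewrite -[leLHS]ger0_norm; last by apply: divr_ge0; [lra | exact: ltW].
  by rewrite -sqrtr_sqr ler_wsqrtr.
have := stage_length_le A L0; have := stage_length_le A LL0; rewrite -/K.
rewrite ler_pdivrMr // in s_large.
have s1 : 1 <= Num.sqrt (n%:R : R).
  rewrite -[leLHS]sqrtr1 ler_wsqrtr //; have := ln_sublinear n0; lra.
have nE := sqr_sqrtr (ltW n0); rewrite -[X in eta * X]nE.
have := ler_wpM2l K0 LLL; have := ler_wpM2l K0 Ls.
have := ler_wpM2r (le_trans ler01 s1) s_large.
move: (Num.sqrt n%:R) (ln n%:R) (ln (ln n%:R)) s1 => s L LL s1.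
have -> : s * eta * s = eta * s ^+ 2 by ring.
lra.
Unshelve. all: by end_near.
Qed.

(** The errors of the three stages, for stages of [n1] steps, of length
    [stage_length A (ln n)], and of length [stage_length A (ln (ln n))]. The
    first two add up to [O(1)], the last is about [3 / A * c * sqrt (ln (ln n))],
    and [15 / 4 > 3] absorbs the bounded terms once [sqrt (ln (ln n)) >= 9]. *)
Lemma stage_errors_small (A c : R) (n n1 : nat) :
  let L := ln (n%:R : R) in let q := lower_tail_ratio (3 / 8 * A) in
  let m2 := stage_length A L in let m3 := stage_length A (ln L) in
    0 < A -> A <= 1 -> 0 < c -> (n1 <= n)%N -> 81 <= ln L ->
  (c * Num.sqrt n1%:R * q ^+ m2 + c * Num.sqrt m2%:R) * q ^+ m3
    + c * Num.sqrt m3%:R < 15 / 16 * (4 / A * c * Num.sqrt (ln L)).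
Proof.
move=> L q m2 m3 A0 A1 c0 n1n LL81.
have LL0 : 0 <= ln L by apply: le_trans LL81.
have L0 : 0 < L.
  by rewrite ltNge; apply/negP => L0; rewrite ln0 // in LL81; lra.
have L1 : 1 <= L.
  by apply/ltW/(le_lt_trans _ (ln_sublinear L0))/(le_trans _ LL81); lra.
have n0 : (0 : R) < n%:R.
  by rewrite ltNge; apply/negP => n0; rewrite /L ln0 // ltxx in L0.
have nL : 1 <= n%:R :> R by apply: le_trans L1 (ltW (ln_sublinear n0)).
have := stage_length_decay A0 LL0; rewrite -/q -/m3 expRN lnK //.
have := stage_length_decay A0 (ltW L0); rewrite -/q -/m2 expRN lnK //.
have := sqrt_stage_length A0 LL0; have := sqrt_stage_length A0 (ltW L0).
rewrite -/m2 -/m3; have : 0 <= q ^+ m3 by rewrite exprn_ge0 ?expR_ge0.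
have : 0 <= q ^+ m2 by rewrite exprn_ge0 ?expR_ge0.
have n1_le : Num.sqrt n1%:R <= n%:R :> R.
  apply: (@le_trans _ _ (Num.sqrt (n%:R ^+ 2))); last by rewrite sqrtr_sqr ger0_norm.
  rewrite ler_wsqrtr // -natrX ler_nat; apply: leq_trans n1n _.
  by rewrite leq_pmulr // -(ltr_nat R).
have s1 : 1 <= Num.sqrt L by rewrite -[leLHS]sqrtr1 ler_wsqrtr.
have sE : Num.sqrt L ^+ 2 = L by rewrite sqr_sqrtr // ltW.
have y9 : 9 <= Num.sqrt (ln L).
  by rewrite -[leLHS]ger0_norm // -sqrtr_sqr ler_wsqrtr // -natrX.
have r10 : 0 <= Num.sqrt n1%:R :> R by exact: sqrtr_ge0.
have r20 : 0 <= Num.sqrt m2%:R :> R by exact: sqrtr_ge0.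
have iA : 1 <= A^-1 by rewrite invf_ge1.
move: iA (Num.sqrt (ln L)) (Num.sqrt L) s1 sE y9 r10 r20 n1_le n0 L0 L1.
move: (Num.sqrt m2%:R) (Num.sqrt m3%:R) (Num.sqrt n1%:R) (q ^+ m2) (q ^+ m3).
move: (A^-1) (n%:R : R) L {LL81 LL0 nL q m2 m3 n1n} => a N L.
move=> r2 r3 r1 q2 q3 a1 y s s1 sE y9 r10 r20 r1N N0 L0 L1 q20 q30 r2s r3y q2N q3L.
have e1 : r1 * q2 <= 1 by rewrite -(mulfV (lt0r_neq0 N0)); exact: ler_pM.
have q31 : q3 <= 1 by apply: le_trans q3L _; rewrite invf_le1.
have e1' : r1 * q2 * q3 <= 1 by rewrite -[leRHS]mulr1; apply: ler_pM; rewrite ?mulr_ge0.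
have e2 : r2 * q3 <= 3 * a + 1.
  apply: (@le_trans _ _ ((3 * a * s + 1) / L)); first exact: ler_pM.
  by rewrite ler_pdivrMr // -sE; nra.
rewrite [ltLHS](_ : _ = c * (r1 * q2 * q3 + r2 * q3 + r3)); last by ring.
rewrite [ltRHS](_ : _ = c * (15 / 4 * (a * y))); last by field.
rewrite ltr_pM2l //; have : a * 9 <= a * y by rewrite ler_wpM2l //; lra.
lra.
Qed.

(** With [A = 1 - 2 * f], the last two stages have lengths
    [stage_length A (ln n)] and [stage_length A (ln (ln n))], and the first takes
    the remaining steps. Discarding tails leaves at least 15/16 of the expected
    [4 / A * c * sqrt (ln (ln n))] chips, more than the errors. *)
Lemma near_paul_can_win (f c : R) (M : nat -> nat) :
    0 < f -> f < 1 / 2 -> interval_discrepancy_constant c ->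
    (forall n, threshold f c n <= (M n)%:R) ->
  \forall n \near \oo,
    paul_can_win n (all_clean (e := Num.truncn (f * n%:R)) (M n)).
Proof.
move=> f0 f12 hc hM; have c0 : 0 < c by case: hc.
pose A := 1 - 2 * f; have A0 : 0 < A by rewrite /A; lra.
(* Any [x < A / 2] leaves room for an upper tail, as [1/2 - x > f], while a
   larger [x] shortens the stages; the margin [A / 8] between [f] and
   [1/2 - x] is shared equally. [phi] exceeds [f] because [e <= phi * n1]
   is needed with [n1 < n], and [ga] drives the upper tail. *)
pose x := 3 / 8 * A; pose phi := f + A / 16; pose ga := A / 16.
have A1 : A <= 1 by rewrite /A; lra.
have hx : 0 <= x <= 3 / 8.
  rewrite mulr_ge0 ?(ltW A0) //= -[leRHS]mulr1; exact: ler_wpM2l.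
have ga0 : 0 < ga by rewrite divr_gt0.
have phi0 : 0 <= phi by rewrite addr_ge0 // ltW.
have phiga : phi + ga = 1 / 2 - x by rewrite /phi /ga /x /A; field.
pose del := upper_tail_ratio phi ga.
have del0 : 0 <= del by apply: upper_tail_ratio_ge0 => //; exact: ltW.
have del1 : del < 1 by apply: upper_tail_ratio_lt1; rewrite // /phi /ga /A; lra.
(* Losing 1/32 in each stage leaves 15/16 of the 4, well above 3. *)
have lose (F P u v b : R) : 0 <= F -> F <= P * b -> 31 / 32 <= u -> 31 / 32 <= v ->
    15 / 16 * F <= P * u * v * b.
  move=> F0 FP u1 v1; rewrite [leRHS](_ : _ = u * v * (P * b)); last by ring.
  apply: ler_pM => //.
  apply: (@le_trans _ _ (31 / 32 * (31 / 32))); first by lra.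
  by apply: ler_pM => //; lra.
have /cvgr0_norm_le/(_ (1 / 32)) : (GRing.exp del : R^nat) @ \oo --> (0 : R).
  by apply: cvg_expr; rewrite ger0_norm.
move=> /(_ ltac:(lra))[N _ delN].
near=> n.
have LL81 : 81 <= ln (ln (n%:R : R)) by near: n; exact: near_ln_ln.
have LLN : N%:R <= ln (ln (n%:R : R)) by near: n; exact: near_ln_ln.
have hm : (stage_length A (ln n%:R))%:R + (stage_length A (ln (ln n%:R)))%:R
    <= A / 16 * n%:R by near: n; apply: near_stage_lengths_small; lra.
pose L := ln (n%:R : R); pose LL := ln L; rewrite -/L -/LL in LL81 LLN hm.
have L0 : 0 < L.
  by rewrite ltNge; apply/negP => L0; move: LL81; rewrite /LL ln0 //; lra.
have LLL : LL < L by apply: ln_sublinear.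
have LL0 : 0 <= LL by apply: le_trans LL81.
have n0 : (0 : R) < n%:R.
  by rewrite ltNge; apply/negP => n0; move: L0; rewrite /L ln0 // ltxx.
pose m2 := stage_length A L; pose m3 := stage_length A LL.
rewrite -/m2 -/m3 in hm.
have m23 : (m2 + m3 <= n)%N.
  rewrite -(ler_nat R) natrD; apply: le_trans hm _.
  by rewrite ler_piMl //; rewrite /A; lra.
pose n1 := (n - (m2 + m3))%N; pose e := Num.truncn (f * n%:R).
have nE : n = (n1 + m2 + m3)%N by rewrite -addnA subnK.
have en1 : e%:Z%:~R <= phi * n1%:R.
  apply: (@le_trans _ _ (f * n%:R)).
    by rewrite truncn_le mulr_ge0 // ltW.
  rewrite natrB // natrD /phi.
  have : f * (m2%:R + m3%:R) <= 1 / 2 * (A / 16 * n%:R).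
    by apply: ler_pM => //; rewrite ?addr_ge0 // ltW.
  have : 0 <= A * n%:R by rewrite mulr_ge0 // ltW.
  have : A / 16 * (m2%:R + m3%:R) <= 1 / 16 * (A / 16 * n%:R).
    by apply: ler_pM => //; rewrite ?addr_ge0 ?divr_ge0 // ?ltW // /A; lra.
  lra.
apply: paul_can_win_all_clean.
have -> : (2 * e%:Z - n%:Z + 1)%R = (2 * e%:Z - (n1 + m2 + m3)%N%:Z + 1)%R by rewrite -nE.
rewrite {2}nE -(ltr_nat R).
have := survivors_three_stages (M n) m2 m3 hc hx phi0 ga0 phiga en1.
apply: lt_le_trans; rewrite subr_gt0 -/del -nE.
have tail_small L' : LL <= L' -> 31 / 32 <= 1 - del ^+ stage_length A L'.
  move=> LL'; have L'0 := le_trans LL0 LL'; have : (N <= stage_length A L')%N.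
    rewrite -(ler_nat R); apply: le_trans LLN _; apply: le_trans LL' _.
    apply: le_trans (ltW (stage_length_gt A L'0)); rewrite -[leLHS]mul1r ler_wpM2r //.
    by rewrite exprn_ege1 // ler_pdivlMr //; rewrite /A; lra.
  by move=> /delN /=; rewrite ger0_norm ?exprn_ge0 //; lra.
have main : 15 / 16 * final_count f c n
    <= (M n)%:R / 2 ^+ n * (1 - del ^+ m2) * (1 - del ^+ m3) * ball_size R n e.
  have b0 : 0 < ball_size R n e by rewrite ltr0n binom_le_gt0.
  have F0 : 0 <= final_count f c n.
    by rewrite !mulr_ge0 ?sqrtr_ge0 ?invr_ge0 // ltW.
  have FM : final_count f c n <= (M n)%:R / 2 ^+ n * ball_size R n e.
    have := hM n; rewrite /threshold -/e mulrAC ler_pdivrMr // mulrC => h.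
    by rewrite mulrAC ler_pdivlMr ?exprn_gt0.
  exact: lose (F0) FM (tail_small L (ltW LLL)) (tail_small LL (lexx _)).
apply: lt_le_trans main.
exact: (stage_errors_small A0 A1 c0 (leq_subr _ _) LL81).
Unshelve. all: by end_near.
Qed.

(** Rounding up changes the threshold by at most 1, and it tends to infinity:
    [2 ^+ n / binom_le n k >= 1] and [sqrt (ln (ln n))] is unbounded. *)
Lemma succ_truncn_threshold (f c : R) : 0 < f -> f < 1 / 2 -> 0 < c ->
  exists2 eps : nat -> R, eps n @[n --> \oo] --> (0 : R) &
    \forall n \near \oo,
      (Num.truncn (threshold f c n)).+1%:R = threshold f c n * (1 + eps n).
Proof.
move=> f0 f12 c0; pose A := 1 - 2 * f; have A0 : 0 < A by rewrite /A; lra.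
pose C := 4 / A * c; have C0 : 0 < C by rewrite !mulr_gt0 ?invr_gt0.
have big B : 0 < B -> \forall n \near \oo, B <= threshold f c n.
  move=> B0; near=> n.
  have h : (B / C) ^+ 2 <= ln (ln (n%:R : R)) by near: n; exact: near_ln_ln.
  have b0 : (0 : R) < (binom_le n (Num.truncn (f * n%:R)))%:R.
    by rewrite ltr0n binom_le_gt0.
  have y_large : B / C <= Num.sqrt (ln (ln (n%:R : R))).
    rewrite -[leLHS]ger0_norm ?divr_ge0 ?(ltW B0) ?(ltW C0) //.
    by rewrite -sqrtr_sqr ler_wsqrtr.
  rewrite -[leLHS]mul1r; apply: ler_pM; rewrite ?(ltW B0) //.
    by rewrite ler_pdivlMr // mul1r; exact: (@ball_size_le R n (Posz _)).
  by rewrite ler_pdivrMr // mulrC in y_large.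
exists (fun n => (Num.truncn (threshold f c n)).+1%:R / threshold f c n - 1).
  apply/cvgr0Pnorm_le => eps eps0; near=> n.
  have X0 : eps^-1 <= threshold f c n by near: n; apply: big; rewrite invr_gt0.
  have Xp : 0 < threshold f c n by apply: lt_le_trans X0; rewrite invr_gt0.
  have /andP[t1 t2] := truncn_itv (ltW Xp); rewrite -natr1 in t2 *.
  have -> a : (a + 1) / threshold f c n - 1 = (a + 1 - threshold f c n) / threshold f c n.
    by field; rewrite gt_eqF.
  rewrite normrM normfV (ger0_norm (ltW Xp)) ler_pdivrMr // ger0_norm; last by lra.
  have : 1 <= eps * threshold f c n by rewrite mulrC -ler_pdivrMr // div1r.
  lra.
near=> n.
have X1 : 1 <= threshold f c n by near: n; exact: big.
by field; rewrite gt_eqF //; lra.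
Unshelve. all: by end_near.
Qed.
End Final.

Theorem theorem4 (R : realType) (f : R) (hf0 : 0 < f) (hf : f < 1 / 2)
    (c' : R) (hc' : interval_discrepancy_constant c') :
  exists M : nat -> nat,
    [/\ forall n, (0 < M n)%N,
        exists2 eps : nat -> R, eps n @[n --> \oo] --> (0 : R) &
          \forall n \near \oo,
            (M n)%:R
            = 2 ^+ n / (binom_le n (Num.truncn (f * n%:R)))%:R
              * (4 / (1 - 2 * f) * c' * Num.sqrt (ln (ln n%:R)))
              * (1 + eps n)
      & \forall n \near \oo,
          paul_can_win n (all_clean (e := Num.truncn (f * n%:R)) (M n))].
Proof.
exists (fun n => (Num.truncn (threshold f c' n)).+1); split => //.
  by apply: succ_truncn_threshold => //; case: hc'.
by apply: near_paul_can_win hc' _ => // n; apply/ltW/truncnS_gt.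
Qed.
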